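(* If $n\geq 5$ and $Q_n$ is the $n$-dimensional hypercube, then $$\rho'(Q_n)\leq 4\lceil \log_2 n\rceil-2.$$
   Context: The hypercube $Q_n$ is the Cartesian product of $n$ copies of $K_2$. An edge coloring of a graph is distinguishing if no automorphism other than the identity preserves it. $D'(G)$ is the least number of colors in a distinguishing edge coloring of $G$. When $D'(G)=2$, the cost of edge-distinguishing $\rho'(G)$ is the minimum number of edges in the smaller color class over all distinguishing edge colorings of $G$ with two colors. *)

(* Defs.v *)
From mathcomp Require Import all_boot all_fingroup.

Set Implicit Arguments.
Unset Strict Implicit.
Unset Printing Implicit Defensive.

Record sgraph := SGraph {
  vertex :> finType;
  adj : rel vertex;
  adj_sym : symmetric adj;
  adj_irr : irreflexive adj }.

Definition complete_rel (T : finType) : rel T := fun x y => x != y.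

Lemma complete_rel_sym (T : finType) : symmetric (@complete_rel T).
Proof. by move=> x y; rewrite /complete_rel eq_sym. Qed.

Lemma complete_rel_irr (T : finType) : irreflexive (@complete_rel T).
Proof. by move=> x; rewrite /complete_rel eqxx. Qed.

Definition complete_graph (k : nat) : sgraph :=
  SGraph (@complete_rel_sym 'I_k) (@complete_rel_irr 'I_k).

(* Two vertices of the Cartesian product are adjacent when they are adjacent in
   one coordinate and agree in all the others. *)
Definition cart_power_rel (G : sgraph) (n : nat) : rel {ffun 'I_n -> G} :=
  fun x y => [exists i, adj (x i) (y i) && [forall (j | j != i), x j == y j]].

Lemma cart_power_rel_sym (G : sgraph) (n : nat) :
  symmetric (@cart_power_rel G n).
Proof.
move=> x y; apply: eq_existsb => i; rewrite adj_sym; congr (_ && _).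
by apply: eq_forallb => j; rewrite [x j == _]eq_sym.
Qed.

Lemma cart_power_rel_irr (G : sgraph) (n : nat) :
  irreflexive (@cart_power_rel G n).
Proof. by move=> x; apply/negbTE/existsPn => i; rewrite adj_irr. Qed.

Definition cart_power (G : sgraph) (n : nat) : sgraph :=
  SGraph (@cart_power_rel_sym G n) (@cart_power_rel_irr G n).

Definition hypercube (n : nat) : sgraph := cart_power (complete_graph 2) n.

Definition edge_set (G : sgraph) : {set {set G}} :=
  [set E : {set G} | [exists x, exists y, adj x y && (E == [set x; y])]].

Definition edge (G : sgraph) : finType := {E : {set G} | E \in edge_set G}.

Definition is_automorphism (G : sgraph) (p : {perm G}) : Prop :=
  forall x y : G, adj (p x) (p y) = adj x y.

(* Not required to be proper, nor to use all k colors. *)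
Definition edge_coloring (G : sgraph) (k : nat) := {ffun edge G -> 'I_k}.

Definition preserves (G : sgraph) (k : nat) (p : {perm G})
    (c : edge_coloring G k) : Prop :=
  forall e f : edge G, val f = p @: val e -> c f = c e.

Definition distinguishing (G : sgraph) (k : nat) (c : edge_coloring G k) : Prop :=
  forall p : {perm G}, is_automorphism p -> preserves p c -> p = 1%g.

(* [is_distinguishing_index G k] says D'(G) = k.  It is a relation because some
   graphs, such as K_2, have no distinguishing edge coloring. *)
Definition is_distinguishing_index (G : sgraph) (k : nat) : Prop :=
  (exists c : edge_coloring G k, distinguishing c) /\
  (forall j (c : edge_coloring G j), distinguishing c -> k <= j).

Definition color_class (G : sgraph) (k : nat) (c : edge_coloring G k) (i : 'I_k) :
    {set edge G} :=
  [set e | c e == i].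

Definition smaller_class_size (G : sgraph) (c : edge_coloring G 2) : nat :=
  minn #|color_class c ord0| #|color_class c ord_max|.

(* [is_cost G m] says that the cost rho'(G) is defined and equal to m; rho' is
   only defined for graphs with D'(G) = 2. *)
Definition is_cost (G : sgraph) (m : nat) : Prop :=
  [/\ is_distinguishing_index G 2,
      exists2 c : edge_coloring G 2, distinguishing c & smaller_class_size c = m
    & forall c : edge_coloring G 2, distinguishing c -> m <= smaller_class_size c].

(* Main.v *)
Require Import Defs.
From mathcomp Require Import all_boot all_fingroup.
From mathcomp Require Import zify.

Set Implicit Arguments.
Unset Strict Implicit.
Unset Printing Implicit Defensive.

(** Write k for the ceiling of log_2 n. Every automorphism p of Q_n permutes the
    directions: p x (s j) = x j + p 0 (s j) for a permutation s of the
    coordinates. Color with the second color the edges of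
    - a star {0, e_i}, i <= k,
    - a path {f_i, f_i + e_i}, i < k, where f_i = e_0 + ... + e_(i-1),
    - code edges {w_i, w_i + e_i}, i < k, where w_i has as j-th entry the
      negation of the i-th binary digit of max(j - k, 0).
    These are at most 3k + 1 <= 4k - 2 edges, as k >= 3. Their directions are
    0, ..., k, and 0 is the only vertex incident to
    all of these directions, so a color-preserving p fixes 0. Going up the path
    gives s i = i for i < k, so p fixes each code edge, and hence each w_i,
    whose bits tell the remaining coordinates apart because n <= 2^k. *)

(** * Coordinate flips and adjacency *)

Lemma ord2_neq (a b : 'I_2) : (a != b) = (b == rev_ord a).
Proof. by case: a b => [[|[|?]] ?] [[|[|?]] ?]. Qed.

Definition flip (n : nat) (i : 'I_n) (x : hypercube n) : hypercube n :=
  [ffun j => if j == i then rev_ord (x j) else x j].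

Lemma flip_same (n : nat) (i : 'I_n) (x : hypercube n) :
  flip i x i = rev_ord (x i).
Proof. by rewrite ffunE eqxx. Qed.

Lemma flip_other (n : nat) (i j : 'I_n) (x : hypercube n) :
  j != i -> flip i x j = x j.
Proof. by move=> /negbTE nji; rewrite ffunE nji. Qed.

Lemma flip_eq (n : nat) (i j : 'I_n) (x : hypercube n) :
  (flip i x j == x j) = (j != i).
Proof.
have [->|nji] := eqVneq j i; last by rewrite flip_other ?eqxx.
by rewrite flip_same; case: (x i) => [[|[|?]] ?].
Qed.

Lemma flipK (n : nat) (i : 'I_n) : involutive (@flip n i).
Proof.
by move=> x; apply/ffunP => j; rewrite !ffunE; case: eqP; rewrite ?rev_ordK.
Qed.

Lemma flip_inj2 (n : nat) (i j : 'I_n) (x : hypercube n) :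
  flip i x = flip j x -> i = j.
Proof.
move=> eij; apply/eqP; have := flip_eq i i x.
by rewrite eij flip_eq eqxx => /negbFE.
Qed.

Lemma adj_flipP (n : nat) (x y : hypercube n) :
  reflect (exists i, y = flip i x) (adj x y).
Proof.
apply: (iffP existsP) => [[i /andP[nxy /forallP exy]]|[i ->]]; exists i.
  apply/ffunP => j; rewrite ffunE; case: (eqVneq j i) => [->|nji].
    by apply/eqP; rewrite -ord2_neq.
  by have /implyP/(_ nji)/eqP-> := exy j.
apply/andP; split.
  by rewrite /= /complete_rel eq_sym flip_eq eqxx.
by apply/forallP => j; apply/implyP => nji; rewrite eq_sym flip_eq.
Qed.

Lemma flip_adj (n : nat) (i : 'I_n) (x : hypercube n) : adj x (flip i x).
Proof. by apply/adj_flipP; exists i. Qed.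

(** * Hamming distance and the action of automorphisms on directions *)

Definition hdist (n : nat) (x y : hypercube n) : nat :=
  #|[set i | x i != y i]|.

Lemma hdist_flip (n : nat) (i : 'I_n) (x y : hypercube n) :
  hdist x (flip i y) + (x i != y i) = hdist x y + (x i == y i).
Proof.
rewrite /hdist (cardsD1 i) [in RHS](cardsD1 i) !inE flip_same.
have -> : [set j | x j != flip i y j] :\ i = [set j | x j != y j] :\ i.
  apply/setP => j; rewrite !inE; case: (eqVneq j i) => //= nji.
  by rewrite flip_other.
have -> : (x i != rev_ord (y i)) = (x i == y i).
  by case: (x i) (y i) => [[|[|?]] ?] [[|[|?]] ?].
by case: (x i == y i); lia.
Qed.

Lemma hdist_eq0 (n : nat) (x y : hypercube n) : hdist x y = 0 -> x = y.
Proof.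
move=> /eqP; rewrite cards_eq0 => /eqP e0; apply/ffunP => i.
by have := in_set0 i; rewrite -e0 inE => /negbFE/eqP.
Qed.

(** Induction on the distance: flipping a coordinate where [x] and [y] differ brings [y] one step
    closer, and [f] turns that step into an edge, which changes the distance by at most one. *)
Lemma hdist_contract (n : nat) (f : hypercube n -> hypercube n) :
  (forall x y, adj x y -> adj (f x) (f y)) ->
  forall x y, hdist (f x) (f y) <= hdist x y.
Proof.
move=> fadj x y; move: {2}(hdist x y) (erefl (hdist x y)) => d.
elim: d y => [|d IHd] y exy.
  by rewrite (hdist_eq0 exy) /hdist; apply/subset_leq_card/subsetP => i;
     rewrite !inE eqxx.
have : 0 < #|[set i | x i != y i]| by rewrite -/(hdist x y) exy.
case/card_gt0P => i; rewrite inE => nxy.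
have := hdist_flip i x y; rewrite (negbTE nxy) exy /= => ez.
have {}ez : hdist x (flip i y) = d by lia.
have := IHd _ ez; rewrite ez.
have /adj_flipP[m ->] := fadj _ _ (flip_adj i y).
have := hdist_flip m (f x) (f y); case: (f x m == f y m) => /=; lia.
Qed.

Lemma automorphism_hdist (n : nat) (p : {perm hypercube n}) :
  is_automorphism p -> forall x y, hdist (p x) (p y) = hdist x y.
Proof.
move=> pA x y; apply/eqP; rewrite eqn_leq; apply/andP; split.
  by apply: hdist_contract => u v; rewrite pA.
rewrite -{1}(permK p x) -{1}(permK p y); apply: hdist_contract => u v.
by rewrite -(pA (_ u)) !permKV.
Qed.

Lemma automorphism_directions (n : nat) (p : {perm hypercube n}) :
  is_automorphism p ->
  exists2 s : 'I_n -> 'I_n, injective s &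
    forall x y j, (p x (s j) == p y (s j)) = (x j == y j).
Proof.
move=> pA; pose o : hypercube n := [ffun=> ord0].
have ex j : exists m, p (flip j o) == flip m (p o).
  have : adj (p o) (p (flip j o)) by rewrite pA flip_adj.
  by case/adj_flipP => m ->; exists m.
pose s j := xchoose (ex j); have sP j : p (flip j o) = flip (s j) (p o).
  exact/eqP/(xchooseP (ex j)).
exists s => [i j eij|].
  by apply: (@flip_inj2 _ _ _ o); apply: (@perm_inj _ p); rewrite !sP eij.
(* [x] and [o] agree at [j] exactly when moving from [o] to [flip j o] increases the distance to
   [x]; [p] preserves both distances. *)
have so x j : (p x (s j) == p o (s j)) = (x j == o j).
  have := hdist_flip (s j) (p x) (p o); have := hdist_flip j x o.
  rewrite -sP !automorphism_hdist //.
  by do 2!case: (_ == _) => //=; lia.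
(* With two values, comparing each of two entries with the entry of [p o] decides whether they are
   equal. *)
have eq2 (a b c : 'I_2) : (a == b) = ((a == c) == (b == c)).
  by case: a b c => [[|[|?]] ?] [[|[|?]] ?] [[|[|?]] ?].
by move=> x y j; rewrite (eq2 (p x _) _ (p o (s j))) !so -eq2.
Qed.

Lemma automorphism_flip (n : nat) (p : {perm hypercube n}) (s : 'I_n -> 'I_n) :
  injective s ->
  (forall x y j, (p x (s j) == p y (s j)) = (x j == y j)) ->
  forall i x, p (flip i x) = flip (s i) (p x).
Proof.
move=> sI sP i x; apply/ffunP => m.
have [t sK tK] := injF_bij sI; rewrite -(tK m); move: (t m) => j.
have [->|nji] := eqVneq j i.
  rewrite flip_same; apply/eqP; rewrite -ord2_neq eq_sym sP.
  by rewrite flip_eq eqxx.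
by rewrite flip_other ?(inj_eq sI) //; apply/eqP; rewrite sP flip_eq.
Qed.

(** * Edges and their directions *)

Lemma edge_flip (n : nat) (i : 'I_n) (x : hypercube n) :
  [set x; flip i x] \in edge_set (hypercube n).
Proof.
rewrite inE; apply/existsP; exists x; apply/existsP; exists (flip i x).
by rewrite flip_adj eqxx.
Qed.

Definition in_dir (n : nat) (i : 'I_n) (x : hypercube n) : edge (hypercube n) :=
  exist (fun E => E \in edge_set (hypercube n)) _ (edge_flip i x).

Lemma set_flip_eq (n : nat) (i m : 'I_n) (x u : hypercube n) :
  [set x; flip i x] = [set u; flip m u] ->
  i = m /\ forall j, j != i -> x j = u j.
Proof.
move=> /setP exu; have := exu x; rewrite !inE eqxx /= => /esym/orP.
have := exu (flip i x); rewrite !inE eqxx orbT /= => /esym/orP.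
have nfx : flip i x != x.
  by apply/eqP => /ffunP/(_ i)/eqP; rewrite flip_eq eqxx.
move=> e2 [/eqP ex|/eqP ex].
  subst u; case: e2 => /eqP e2; first by rewrite e2 eqxx in nfx.
  by split=> //; apply: flip_inj2 e2.
case: e2 => /eqP e2; last by rewrite e2 -ex eqxx in nfx.
have eim : i = m by apply: (@flip_inj2 _ _ _ x); rewrite e2 ex flipK.
by split=> // j nji; rewrite -e2 flip_other.
Qed.

(** * The distinguishing index is at least 2, and the cost is attained *)

Lemma distinguishing_index_ge2 (n j : nat) (c : edge_coloring (hypercube n) j) :
  0 < n -> distinguishing c -> 2 <= j.
Proof.
move=> n_gt0 cD; pose i := Ordinal n_gt0; pose o : hypercube n := [ffun=> ord0].
(* The color of an actual edge rules out [j = 0]. For [j = 1] every automorphism preserves [c], in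
   particular the nontrivial flip of coordinate [i]. *)
have cP := ltn_ord (c (in_dir i o)).
case: j c cD cP => [|[|j]] // c cD _.
have fI : injective (@flip n i) := inv_inj (@flipK n i).
have /permP/(_ o) : perm fI = 1%g.
  apply: cD => [x y|e f _]; last by rewrite !ord1.
  rewrite !permE; apply/adj_flipP/adj_flipP => -[m].
    move/(congr1 (flip i)); rewrite flipK => ->; exists m.
    by apply/ffunP => l; rewrite !ffunE; do 2!case: eqP; rewrite ?rev_ordK.
  move=> ->; exists m.
  by apply/ffunP => l; rewrite !ffunE; do 2!case: eqP; rewrite ?rev_ordK.
by rewrite permE perm1 => /ffunP/(_ i)/eqP; rewrite flip_eq eqxx.
Qed.

(** The boolean form allows minimizing over the finite type of colorings. *)
Definition distinguishingb (G : sgraph) (k : nat) (c : edge_coloring G k) :=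
  [forall p : {perm G}, [forall x, forall y, adj (p x) (p y) == adj x y] ==>
     ([forall e : edge G, forall f : edge G,
         (val f == p @: val e) ==> (c f == c e)] ==> (p == 1%g))].

Lemma distinguishingP (G : sgraph) (k : nat) (c : edge_coloring G k) :
  reflect (distinguishing c) (distinguishingb c).
Proof.
apply: (iffP forallP) => cD p; last first.
  apply/implyP => /'forall_forallP pA; apply/implyP => /'forall_forallP pc.
  apply/eqP; apply: cD => [x y|e f /eqP efp]; first exact/eqP/pA.
  exact/eqP/(implyP (pc e f)).
move=> pA pc; apply/eqP; apply: (implyP (implyP (cD p) _)).
  by apply/'forall_forallP => x y; rewrite pA.
by apply/'forall_forallP => e f; apply/implyP => /eqP /pc ->.
Qed.

Lemma cost_exists (G : sgraph) (c : edge_coloring G 2) :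
  is_distinguishing_index G 2 -> distinguishing c ->
  exists2 m, is_cost G m & m <= smaller_class_size c.
Proof.
move=> G2 /distinguishingP cD.
case: (@arg_minnP _ c (@distinguishingb G 2) (@smaller_class_size G) cD).
move=> c' c'D cmin.
exists (smaller_class_size c'); last exact: cmin.
split=> //; first by exists c' => //; apply/distinguishingP.
by move=> d /distinguishingP/cmin.
Qed.

(** * Two-colorings given by a set of edges *)

Definition indicator (G : sgraph) (S : {set {set G}}) : edge_coloring G 2 :=
  [ffun e => if val e \in S then ord_max else ord0].

Lemma indicator_class_size (G : sgraph) (S : {set {set G}}) :
  smaller_class_size (indicator S) <= #|S|.
Proof.
apply: leq_trans (geq_minr _ _) _.
rewrite -(card_imset _ val_inj); apply/subset_leq_card/subsetP => E.
by case/imsetP => e; rewrite inE ffunE => + ->; case: ifP.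
Qed.

Lemma indicator_preserved (n : nat) (S : {set {set hypercube n}})
    (p : {perm hypercube n}) (s : 'I_n -> 'I_n) :
  (forall i x, p (flip i x) = flip (s i) (p x)) -> preserves p (indicator S) ->
  forall i x, [set x; flip i x] \in S -> [set p x; flip (s i) (p x)] \in S.
Proof.
move=> ps pS i x xS; have := pS (in_dir i x) (in_dir (s i) (p x)).
rewrite !ffunE /= xS imsetU1 imset_set1 ps => /(_ erefl).
by case: ifP.
Qed.

(** * Binary digits and the rigid edge set *)

Definition bit (i m : nat) : bool := odd (m %/ 2 ^ i).

(** Induction on [k]: digit 0 is the parity, and halving shifts the other digits down. *)
Lemma bit_inj (k a b : nat) :
  a < 2 ^ k -> b < 2 ^ k -> (forall i, i < k -> bit i a = bit i b) -> a = b.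
Proof.
elim: k a b => [|k IHk] a b; first by rewrite expn0; lia.
rewrite !expnS => ak bk ab.
have := ab 0 isT; rewrite /bit expn0 !divn1 => o.
have h : a./2 = b./2.
  apply: IHk; [lia | lia | move=> i ik].
  by have := ab i.+1 ik; rewrite /bit expnS !divnMA !divn2.
by rewrite -(odd_double_half a) -(odd_double_half b) o h.
Qed.

Lemma bit0 (i : nat) : bit i 0 = false.
Proof. by rewrite /bit div0n. Qed.

Definition vec (n : nat) (b : nat -> bool) : hypercube n :=
  [ffun j : 'I_n => if b j then ord_max else ord0].

Definition on (n : nat) (x : hypercube n) (j : 'I_n) : bool := x j != ord0.

Lemma on_vec (n : nat) (b : nat -> bool) (j : 'I_n) : on (vec n b) j = b j.
Proof. by rewrite /on ffunE; case: (b j). Qed.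

Lemma on_inj (n : nat) (x y : hypercube n) : on x =1 on y -> x = y.
Proof.
move=> xy; apply/ffunP => j; have := xy j; rewrite /on.
by case: (x j) (y j) => [[|[|?]] ?] [[|[|?]] ?] //= _; apply: val_inj.
Qed.

Definition pattern_edge (n : nat) (b : nat -> bool) (i : 'I_n) :
  {set hypercube n} := [set vec n b; flip i (vec n b)].

(* Subtraction truncates: every coordinate j <= k of a code vector is on. *)
Definition code (k i j : nat) : bool := ~~ bit i (j - k).

Definition rigid_edges (n k : nat) : {set {set hypercube n}} :=
  [set pattern_edge (fun=> false) i | i : 'I_n & i < k.+1] :|:
  [set pattern_edge (fun j => j < i) i | i : 'I_n & i < k] :|:
  [set pattern_edge (code k i) i | i : 'I_n & i < k].

Lemma card_ord_lt (n k : nat) : #|[pred i : 'I_n | i < k]| <= k.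
Proof.
rewrite cardE -(size_map val) -[leqRHS](size_iota 0).
apply: uniq_leq_size; first by rewrite (map_inj_uniq val_inj) enum_uniq.
by move=> _ /mapP[i + ->]; rewrite mem_enum mem_iota.
Qed.

Lemma card_rigid_edges (n k : nat) : #|rigid_edges n k| <= 3 * k + 1.
Proof.
have cI m (F : 'I_n -> {set hypercube n}) : #|[set F i | i : 'I_n & i < m]| <= m.
  by apply: leq_trans (leq_imset_card _ _) _; rewrite cardsE card_ord_lt.
have -> : 3 * k + 1 = k.+1 + k + k by lia.
apply: leq_trans (leq_card_setU _ _) (leq_add _ (cI _ _)).
exact: leq_trans (leq_card_setU _ _) (leq_add (cI _ _) (cI _ _)).
Qed.

(** The cases are star, path and code. Coordinate [i] stays free because [x] may be either
    endpoint. *)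
Lemma rigid_edges_inv (n k : nat) (i : 'I_n) (x : hypercube n) :
  [set x; flip i x] \in rigid_edges n k ->
  [\/ i <= k /\ forall j, j != i -> on x j = false,
      i < k /\ forall j, j != i -> on x j = (j < i)
    | i < k /\ forall j, j != i -> on x j = code k i j].
Proof.
have inv b m : [set x; flip i x] = pattern_edge b m ->
    i = m /\ forall j, j != i -> on x j = b j.
  by case/set_flip_eq => <- xb; split=> // j /xb xj; rewrite -on_vec /on xj.
rewrite !inE -orbA => /or3P[] /imsetP[m]; rewrite inE => mk /inv[im xb]; subst m.
- by apply: Or31.
- by apply: Or32.
- by apply: Or33.
Qed.

(** * Rigidity of the edge set *)

Section Rigidity.

Variables (n k : nat) (s : 'I_n -> 'I_n) (p : {perm hypercube n}).
Hypotheses (k_ge3 : 3 <= k) (k_lt_n : k < n) (n_le : n <= 2 ^ k).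
Hypothesis s_inj : injective s.
Hypothesis p_coord : forall x y j, (p x (s j) == p y (s j)) = (x j == y j).
Hypothesis p_edges : forall i x,
  [set x; flip i x] \in rigid_edges n k ->
  [set p x; flip (s i) (p x)] \in rigid_edges n k.

Let o : hypercube n := vec n (fun=> false).

Let star_edge (i : 'I_n) : i <= k -> [set o; flip i o] \in rigid_edges n k.
Proof.
move=> ik; rewrite !inE; apply/orP; left; apply/orP; left.
by apply: imset_f; rewrite inE.
Qed.

Let path_edge (i : 'I_n) :
  i < k ->
  [set vec n (fun j => j < i); flip i (vec n (fun j => j < i))]
    \in rigid_edges n k.
Proof.
move=> ik; rewrite !inE; apply/orP; left; apply/orP; right.
by apply/imsetP; exists i; rewrite ?inE.
Qed.

Let code_edge (i : 'I_n) :
  i < k -> [set vec n (code k i); flip i (vec n (code k i))] \in rigid_edges n k.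
Proof.
by move=> ik; rewrite !inE; apply/orP; right; apply/imsetP; exists i; rewrite ?inE.
Qed.

Let code_le i j : j <= k -> code k i j.
Proof. by rewrite -subn_eq0 /code => /eqP->; rewrite bit0. Qed.

Let ord_k : 'I_n := Ordinal k_lt_n.

(** One of 0, 1, 2 always qualifies. This mainly excludes code edges, whose endpoints are on at
    every coordinate up to [k] off the edge direction. *)
Let avoid2 (a b : 'I_n) : exists2 m : 'I_n, m <= k & (m != a) && (m != b).
Proof.
have n0 : 0 < n by lia.
have n1 : 1 < n by lia.
have n2 : 2 < n by lia.
pose i0 := Ordinal n0; pose i1 := Ordinal n1; pose i2 := Ordinal n2.
have [d0|d0] := boolP ((i0 != a) && (i0 != b)); first by exists i0.
have [d1|d1] := boolP ((i1 != a) && (i1 != b)); first by exists i1 => //=; lia.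
exists i2 => /=; first lia.
by move: d0 d1; rewrite -!val_eqE /=; lia.
Qed.

Let p_origin : p o = o.
Proof.
have sdir (i : 'I_n) : i <= k -> s i <= k.
  by move=> /star_edge/p_edges/rigid_edges_inv[] [] // /ltnW.
(* s maps the k+1 star directions injectively, hence onto, themselves. *)
have [i ik si] : exists2 i : 'I_n, i <= k & s i = ord_k.
  pose D := [set i : 'I_n | i <= k].
  have : s @: D = D.
    apply/eqP; rewrite eqEcard card_imset // leqnn andbT.
    by apply/subsetP => _ /imsetP[i + ->]; rewrite !inE => /sdir.
  move/setP/(_ ord_k); rewrite !inE leqnn => /imsetP[i + si].
  by rewrite inE => ik; exists i.
(* Only the star has an edge in direction [k], so [p o] vanishes off coordinate [k]. A second star
   edge, in direction [l], then settles coordinate [k]. *)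
have off j : j != ord_k -> on (p o) j = false.
  have := p_edges (star_edge ik); rewrite si => /rigid_edges_inv.
  by case=> -[kk e]; [exact: e | rewrite ltnn in kk | rewrite ltnn in kk].
have [l lk /andP[nli _]] := avoid2 i i.
have nsl : ord_k != s l by rewrite -si (inj_eq s_inj) eq_sym.
apply: on_inj => j; rewrite on_vec.
have [->|/off//] := eqVneq j ord_k.
have slk := sdir _ lk.
case/rigid_edges_inv: (p_edges (star_edge lk)) => -[_] e.
- exact: e.
- by rewrite e //=; lia.
- have [m mk /andP[/off + /e]] := avoid2 ord_k (s l).
  by move=> ->; rewrite code_le.
Qed.

(** With the origin fixed, [p] merely permutes coordinates. *)
Let p_on x j : on (p x) (s j) = on x j.
Proof.
have := p_coord x o j; rewrite p_origin /on /o !ffunE => e.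
by rewrite e.
Qed.

Let s_path (i : 'I_n) : i < k -> s i = i.
Proof.
have n0 : 0 < n by lia.
have n1 : 1 < n by lia.
pose i0 := Ordinal n0; pose i1 := Ordinal n1.
(* The induction excludes star edges by coordinate 0 being on, which fails for the zero vertex. So
   the base case uses the path edge in direction 1, sent to an edge at the vertex on exactly at
   [s i0]. *)
have s0 : s i0 = i0.
  have n01 : s i0 != s i1 by rewrite (inj_eq s_inj).
  have e1 j : on (p (vec n (fun j => j < i1))) j = (j == s i0).
    have [t sK tK] := injF_bij s_inj; rewrite -(tK j) p_on on_vec (inj_eq s_inj).
    by rewrite -val_eqE /=; lia.
  have /path_edge/p_edges/rigid_edges_inv : i1 < k by rewrite /=; lia.
  case=> -[m_le] e.
  - by have := e _ n01; rewrite e1 eqxx.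
  - have := e _ n01; rewrite e1 eqxx => /esym lt01.
    have n0s1 : i0 != s i1 by rewrite -val_eqE /=; lia.
    by apply/esym/eqP; rewrite -e1 e //=; lia.
  - have [m mk /andP[ms0 ms1]] := avoid2 (s i0) (s i1).
    by have := e _ ms1; rewrite e1 (negbTE ms0) code_le.
have [m] := ubnP (val i); elim: m i => // m IHm i im ik.
have [i_eq0|i_gt0] := posnP i.
  by have -> : i = i0 by apply: val_inj; rewrite /= i_eq0.
have fixed (j : 'I_n) : j < i -> s j = j.
  by move=> ji; apply: IHm; move: im; rewrite /=; lia.
have pf : p (vec n (fun j => j < i)) = vec n (fun j => j < i).
  apply: on_inj => j'; have [t sK tK] := injF_bij s_inj; rewrite -(tK j').
  move: (t j') => j; rewrite p_on !on_vec; have [ji|ij] := ltnP j i.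
    by rewrite fixed // ji.
  apply/esym; apply: contraTF ij => sji; rewrite -ltnNge.
  by have /s_inj <- := fixed _ sji.
have nsi : i0 != s i by rewrite -s0 (inj_eq s_inj) -val_eqE /=; lia.
have := p_edges (path_edge ik); rewrite pf => /rigid_edges_inv[] [m_le] e.
- by have := e _ nsi; rewrite on_vec i_gt0.
(* If [s i] differs from [i], comparing the two path vertices at [i] gives [s i < i], where [s] is
   already the identity, against injectivity. *)
- have [//|nii] := eqVneq (s i) i.
  have := e i; rewrite eq_sym nii on_vec ltnn => /(_ isT)/esym/negbT.
  rewrite -leqNgt leq_eqVlt val_eqE (negbTE nii) /= => /fixed/s_inj e'.
  by rewrite e' eqxx in nii.
(* A code edge would be on at [k], where the path vertex is off. *)
- have := e ord_k; rewrite on_vec code_le //= -val_eqE /= => /(_ ltac:(lia)).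
  by lia.
Qed.

Let s_ge (j : 'I_n) : k <= j -> k <= s j.
Proof.
move=> kj; rewrite leqNgt; apply/negP => sk.
by have /s_inj e := s_path sk; rewrite e in sk; lia.
Qed.

Let s_id (j : 'I_n) : s j = j.
Proof.
have [/s_path//|kj] := ltnP j k; have skj := s_ge kj.
have lt_s := ltn_ord (s j); have lt_j := ltn_ord j.
suff : s j - k = j - k by move=> e; apply: val_inj => /=; lia.
apply: (@bit_inj k) => [||i ik]; [lia | lia |].
have in_ : i < n by lia.
pose i' := Ordinal in_; have si : s i' = i' by rewrite s_path.
(* The image of the code vertex is on at [s ord_k], beyond all path coordinates, so its edge is
   neither star nor path. Comparing code vectors at [s j] then gives equal digits. *)
have skk : k <= s ord_k by apply: s_ge.
have := p_edges (code_edge (ik : i' < k)); rewrite si.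
case/rigid_edges_inv => -[_] e.
- have := e (s ord_k); rewrite p_on on_vec code_le // -val_eqE /=.
  by move=> /(_ ltac:(lia)).
- have := e (s ord_k); rewrite p_on on_vec code_le // -val_eqE /=.
  by move=> /(_ ltac:(lia)); lia.
- have := e (s j); rewrite p_on on_vec /code -val_eqE /= => /(_ ltac:(lia)).
  by move/negb_inj.
Qed.

Lemma rigid_edges_fixed : p = 1%g.
Proof.
apply/permP => x; rewrite perm1; apply: on_inj => j.
by rewrite -{1}(s_id j) p_on.
Qed.

End Rigidity.

(** * The upper bound on the cost *)

Lemma indicator_rigid_edges (n k : nat) :
  3 <= k -> k < n -> n <= 2 ^ k -> distinguishing (indicator (rigid_edges n k)).
Proof.
move=> k3 kn nk p pA pS; have [s sI sP] := automorphism_directions pA.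
apply: (rigid_edges_fixed k3 kn nk sI sP).
exact: indicator_preserved (automorphism_flip sI sP) pS.
Qed.

(* [up_log 2 n] is the least e with n <= 2 ^ e, i.e. the ceiling of log_2 n; the
   subtraction never truncates since n >= 5. *)
Theorem theorem5p11 (n : nat) (hn : 5 <= n) :
  exists2 m : nat, is_cost (hypercube n) m & m <= 4 * up_log 2 n - 2.
Proof.
set k := up_log 2 n.
have n_le : n <= 2 ^ k by apply: up_logP.
have k_ge3 : 3 <= k.
  rewrite ltnNge; apply/negP => k2.
  by have := leq_trans n_le (leq_pexp2l (isT : 0 < 2) k2); lia.
(* Minimality of [k] gives [2 ^ k.-1 < n], and [k.-1 < 2 ^ k.-1]. *)
have k_lt_n : k < n.
  have n1 : 1 < n by lia.
  have := up_log_gtn (isT : 1 < 2) n1; rewrite -/k.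
  have := ltn_expl k.-1 (isT : 1 < 2); lia.
have cD := indicator_rigid_edges k_ge3 k_lt_n n_le.
have D2 : is_distinguishing_index (hypercube n) 2.
  split; first by exists (indicator (rigid_edges n k)).
  by move=> j c; apply: distinguishing_index_ge2; lia.
have [m mC m_le] := cost_exists D2 cD; exists m => //.
have := indicator_class_size (rigid_edges n k).
have := card_rigid_edges n k; lia.
Qed.
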